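(* Let $-1<c<0$, $-1<a<1$, and $d\in\mathbb{R}$. Let $t\in\mathbb{C}$ satisfy both $|t|<1$ and $|t|(1-|t|)^c<\dfrac{|c|^c}{(c+1)^{c+1}}$. Then $$\frac{t}{1+a}\;{}_2F_1\left(1,\,1+d;\,2+a;\,t\right)=(1-t)^{a(c+1)-d}\sum_{n=1}^\infty\left(t(1-t)^c\right)^n\frac{(1-d+a(c+1)+nc)_{n-1}}{(n-1)!\,(n+a)}.$$
   Context: ${}_2F_1(\alpha,\beta;\gamma;t)=\sum_{n\ge0}\frac{(\alpha)_n(\beta)_n}{(\gamma)_n}\frac{t^n}{n!}$ is the Gauss hypergeometric function, and $(x)_n=x(x+1)\cdots(x+n-1)$ (with $(x)_0=1$) is the Pochhammer symbol (rising factorial). Complex powers of $1-t$ are taken with the principal branch of the logarithm. *)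

(* Defs.v *)
From Stdlib Require Export Reals Factorial.
From Coquelicot Require Export Coquelicot.

Open Scope R_scope.

(* Principal argument, with values in (-PI, PI]; since [acos] ranges over
   [0, PI], the sign is that of the imaginary part. Junk value at 0. *)
Definition Carg (z : C) : R :=
  if Rle_dec 0 (Im z) then acos (Re z / Cmod z) else - acos (Re z / Cmod z).

Definition Clog (z : C) : C := (ln (Cmod z), Carg z).

Definition Cexp (z : C) : C := (exp (Re z) * cos (Im z), exp (Re z) * sin (Im z)).

(* Meaningful for [z <> 0] only. *)
Definition Cpower (z w : C) : C := Cexp (w * Clog z)%C.

Fixpoint Cpochhammer (x : C) (n : nat) : C :=
  match n with
  | O => 1
  | S m => (Cpochhammer x m * (x + INR m))%C
  end.

(* Sum of a complex series, meaningful only when the series converges. *)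
Definition CSeries (u : nat -> C) : C :=
  (Series (fun n => Re (u n)), Series (fun n => Im (u n))).

Lemma CSeries_unique (u : nat -> C) (l : C) :
  @is_series C_AbsRing C_NormedModule u l -> CSeries u = l.
Proof.
intros H.
assert (Hp : forall n, sum_n u n = (sum_n (fun k => Re (u k)) n,
                                    sum_n (fun k => Im (u k)) n)).
{ induction n as [|n IH].
  - rewrite !sum_O. now destruct (u O).
  - rewrite !sum_Sn, IH. now destruct (u (S n)). }
assert (H1 : is_series (fun n => Re (u n)) (Re l)).
{ apply filterlim_ext with (fun n => fst (sum_n u n)).
  - intros n. now rewrite Hp.
  - eapply filterlim_comp with (G := @locally C_UniformSpace l) (g := fst : C -> R).
    + exact H.
    + apply (@continuous_fst R_UniformSpace R_UniformSpace). }
assert (H2 : is_series (fun n => Im (u n)) (Im l)).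
{ apply filterlim_ext with (fun n => snd (sum_n u n)).
  - intros n. now rewrite Hp.
  - eapply filterlim_comp with (G := @locally C_UniformSpace l) (g := snd : C -> R).
    + exact H.
    + apply (@continuous_snd R_UniformSpace R_UniformSpace). }
unfold CSeries.
rewrite (is_series_unique _ _ H1), (is_series_unique _ _ H2).
now destruct l.
Qed.

Definition hyp2F1_term (alpha beta gamma t : C) (n : nat) : C :=
  (Cpochhammer alpha n * Cpochhammer beta n / Cpochhammer gamma n
   * (t ^ n / INR (fact n)))%C.

Definition hyp2F1 (alpha beta gamma t : C) : C :=
  CSeries (hyp2F1_term alpha beta gamma t).

(* Main.v *)
Require Import Defs.
From Stdlib Require Import Reals Factorial Lra Lia.
From Coquelicot Require Import Coquelicot.

(** Put [e_n = (n+1) c + a (c+1) - d] and let [b_n] be the coefficient of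
    [(t (1-t)^c)^(n+1)] in the right-hand series. After the powers of [1 - t]
    are merged, the right-hand side is [t * sum_n b_n t^n (1-t)^(e_n)]. Expanding every
    [(1-t)^(e_n)] in powers of [t] turns this into a double series, and summing
    it along the diagonals gives the hypergeometric series term by term. So the
    identity needs two facts: the diagonal sums are right, and the double series
    converges absolutely.

    Diagonal sums. The Pochhammer symbol in [b_n] and the one in the binomial
    coefficient of [(1-t)^(e_n)] join into one product of [N] consecutive
    factors, which is a polynomial of degree [N] in [y_n = n + 1 + a]. The
    diagonal sum is therefore an [N]-th difference of [P(y_n) / y_n], where [P]
    has degree [N]. Modulo polynomials of degree below [N], which such a
    difference kills, [P(y) / y] is [P(0) / y], whose [N]-th difference is
    explicit ([convolution_identity]).

    Absolute convergence. With [th = |c|], the sum of the absolute values in row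
    [n] is at most [|b_n| |t|^n (1-|t|)^(- (n+1) th - const)], since the
    coefficients of [(1-x)^(-s)] are nonnegative for [s >= 0]. On the other
    hand [|b_n|] is at most a polynomial in [n] times
    [(th^th (1-th)^(1-th))^n] ([poch_growth]); the hypothesis on [t] says
    exactly that the product of the two geometric rates is below 1
    ([ex_series_majorant]). *)

(** * Rising factorials and finite differences *)

(** All parameters of the theorem are real, so the combinatorics takes place
    in [R]; [Cpochhammer_RtoC] is the link with the complex symbol. *)
Fixpoint poch (x : R) (n : nat) : R :=
  match n with
  | O => 1
  | S m => poch x m * (x + INR m)
  end.

Lemma Cpochhammer_RtoC (x : R) (n : nat) :
  Cpochhammer (RtoC x) n = RtoC (poch x n).
Proof.
  induction n as [|n IH]; simpl; [reflexivity|].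
  rewrite IH. now rewrite <- RtoC_plus, <- RtoC_mult.
Qed.

Lemma poch_S_l (x : R) (n : nat) : poch x (S n) = x * poch (x + 1) n.
Proof.
  induction n as [|n IH].
  - simpl. ring.
  - change (poch x (S n) * (x + INR (S n))
            = x * (poch (x + 1) n * (x + 1 + INR n))).
    rewrite IH, S_INR. ring.
Qed.

Lemma poch_add (x : R) (n m : nat) :
  poch x (n + m) = poch x n * poch (x + INR n) m.
Proof.
  induction m as [|m IH].
  - rewrite Nat.add_0_r. simpl. ring.
  - rewrite Nat.add_succ_r. simpl. rewrite IH, plus_INR. ring.
Qed.

(** Reading the product backwards: the arguments [1-x-n, ..., -x] are the
    opposites of [x, ..., x+n-1]. *)
Lemma poch_reflect (x : R) (n : nat) :
  poch (1 - x - INR n) n = (-1) ^ n * poch x n.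
Proof.
  revert x. induction n as [|n IH]; intros x.
  - simpl. ring.
  - rewrite poch_S_l.
    replace (1 - x - INR (S n) + 1) with (1 - x - INR n) by (rewrite S_INR; ring).
    rewrite IH, S_INR. simpl. ring.
Qed.

Lemma poch_pos (x : R) (n : nat) : 0 < x -> 0 < poch x n.
Proof.
  intros Hx. induction n as [|n IH]; simpl; [lra|].
  apply Rmult_lt_0_compat; [exact IH|]. pose proof (pos_INR n). lra.
Qed.

Lemma poch_abs_le (x y : R) (n : nat) :
  Rabs x <= y -> Rabs (poch x n) <= poch y n.
Proof.
  intros Hxy. induction n as [|n IH]; simpl.
  - rewrite Rabs_R1. lra.
  - rewrite Rabs_mult.
    apply Rmult_le_compat; try apply Rabs_pos; try exact IH.
    apply Rle_trans with (1 := Rabs_triang _ _).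
    rewrite (Rabs_pos_eq (INR n)) by apply pos_INR. lra.
Qed.

Lemma fact_S_INR (n : nat) : INR (fact (S n)) = (INR n + 1) * INR (fact n).
Proof. rewrite fact_simpl, mult_INR, S_INR. ring. Qed.

Lemma poch_1 (n : nat) : poch 1 n = INR (fact n).
Proof.
  induction n as [|n IH]; [reflexivity|]. simpl poch.
  rewrite IH, fact_S_INR. ring.
Qed.

(** The [M]-th forward difference at 0 divided by [(-1)^M M!]; this
    normalization makes the weights satisfy the two recurrences below. *)
Definition altdiff (M : nat) (f : nat -> R) : R :=
  sum_f_R0 (fun i => (-1) ^ i / (INR (fact i) * INR (fact (M - i))) * f i) M.

Lemma altdiff_ext (M : nat) (f g : nat -> R) :
  (forall i, (i <= M)%nat -> f i = g i) -> altdiff M f = altdiff M g.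
Proof.
  intros H. apply sum_eq. intros i Hi. now rewrite H.
Qed.

Lemma altdiff_lin (M : nat) (a b : R) (f g : nat -> R) :
  altdiff M (fun i => a * f i + b * g i) = a * altdiff M f + b * altdiff M g.
Proof.
  unfold altdiff. rewrite !scal_sum, <- plus_sum.
  apply sum_eq. intros i _. ring.
Qed.

(** Leibniz rule for multiplication by the index; at 0 the undifferentiated
    factor vanishes. *)
Lemma altdiff_mul_index (M : nat) (f : nat -> R) :
  altdiff (S M) (fun i => INR i * f i) = - altdiff M (fun i => f (S i)).
Proof.
  unfold altdiff. rewrite decomp_sum by lia.
  replace (- _) with ((-1) * sum_f_R0 (fun i : nat =>
    (-1) ^ i / (INR (fact i) * INR (fact (M - i))) * f (S i)) M) by ring.
  rewrite scal_sum. simpl (pred (S M)).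
  match goal with |- ?u + _ = _ => replace u with 0 by (simpl; ring) end.
  rewrite Rplus_0_l. apply sum_eq. intros i Hi.
  rewrite Nat.sub_succ, fact_S_INR, S_INR, <- tech_pow_Rmult.
  pose proof (pos_INR i). pose proof (INR_fact_neq_0 i).
  pose proof (INR_fact_neq_0 (M - i)).
  field. repeat split; trivial; lra.
Qed.

Lemma altdiff_recurrence (M : nat) (f : nat -> R) :
  INR (S M) * altdiff (S M) f = altdiff M f - altdiff M (fun i => f (S i)).
Proof.
  enough (H : altdiff (S M) (fun i => (INR (S M) - INR i) * f i) = altdiff M f).
  { unfold Rminus at 1. rewrite <- altdiff_mul_index, <- H.
    rewrite <- (Rmult_1_l (altdiff (S M) (fun i => INR i * f i))).
    rewrite <- (Rmult_1_l (altdiff (S M) (fun i => (_ - _) * f i))).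
    rewrite <- altdiff_lin, <- (Rplus_0_r (INR (S M) * _)).
    rewrite <- (Rmult_0_l (altdiff (S M) f)), <- altdiff_lin.
    apply altdiff_ext. intros i _. ring. }
  unfold altdiff. rewrite tech5, Rminus_diag, Rmult_0_l, Rmult_0_r, Rplus_0_r.
  apply sum_eq. intros i Hi.
  rewrite Nat.sub_succ_l by exact Hi.
  rewrite fact_S_INR, S_INR, minus_INR by exact Hi.
  pose proof (INR_fact_neq_0 i). pose proof (INR_fact_neq_0 (M - i)).
  apply le_INR in Hi.
  field. repeat split; trivial; lra.
Qed.

Lemma altdiff_inv (M : nat) (y : R) :
  0 < y -> altdiff M (fun i => / (y + INR i)) = / poch y (S M).
Proof.
  revert y. induction M as [|M IH]; intros y Hy.
  - unfold altdiff. simpl. field. lra.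
  - apply Rmult_eq_reg_l with (INR (S M)); [|apply not_0_INR; lia].
    rewrite altdiff_recurrence, IH by exact Hy.
    rewrite (altdiff_ext _ _ (fun i => / (y + 1 + INR i))).
    2: { intros i _. rewrite S_INR. f_equal. ring. }
    rewrite IH by lra.
    pose proof (poch_pos (y + 1) (S M) ltac:(lra)) as H1.
    pose proof (poch_pos (y + 1) M ltac:(lra)) as H2.
    rewrite (poch_S_l y (S M)), (poch_S_l y M).
    simpl poch in *. rewrite S_INR. pose proof (pos_INR M).
    field. repeat split; lra.
Qed.

(** A difference of order [M] kills polynomials of degree [r < M]. The
    induction peels off one linear factor with the Leibniz rule, which
    lowers both [r] and [M]. *)
Lemma altdiff_poch_zero (r M : nat) (b g : R) :
  (r < M)%nat -> altdiff M (fun i => poch (b + g * INR i) r) = 0.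
Proof.
  revert M b. induction r as [|r IH]; intros [|M] b Hr; try lia.
  - apply Rmult_eq_reg_l with (INR (S M)); [|apply not_0_INR; lia].
    rewrite altdiff_recurrence. simpl poch. ring.
  - rewrite (altdiff_ext _ _ (fun i =>
      (b + INR r) * poch (b + g * INR i) r
      + g * (INR i * poch (b + g * INR i) r))).
    2: { intros i _. simpl. ring. }
    rewrite altdiff_lin, IH, altdiff_mul_index by lia.
    rewrite (altdiff_ext _ _ (fun i => poch (b + g + g * INR i) r)).
    2: { intros i _. rewrite S_INR. f_equal. ring. }
    rewrite IH by lia. ring.
Qed.

(** Only the value at [y + i = 0] of the numerator survives: replacing one
    linear factor [b + r - g (y + i)] by its constant term [b + r] changes
    the quotient by a polynomial of degree [r < M]. *)
Lemma altdiff_poch_div (r M : nat) (b g y : R) :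
  0 < y -> (r <= M)%nat ->
  altdiff M (fun i => poch (b - g * (y + INR i)) r / (y + INR i))
  = poch b r / poch y (S M).
Proof.
  intros Hy. induction r as [|r IH]; intros Hr.
  - simpl (poch b 0). unfold Rdiv. rewrite Rmult_1_l, <- altdiff_inv by exact Hy.
    apply altdiff_ext. intros i _. simpl. ring.
  - rewrite (altdiff_ext _ _ (fun i =>
      (b + INR r) * (poch (b - g * (y + INR i)) r / (y + INR i))
      + (- g) * poch (b - g * y + (- g) * INR i) r)).
    2: { intros i _. simpl. pose proof (pos_INR i).
         replace (b - g * y + - g * INR i) with (b - g * (y + INR i)) by ring.
         field. lra. }
    rewrite altdiff_lin, IH, altdiff_poch_zero by lia.
    simpl (poch b (S r)). unfold Rdiv. ring.
Qed.

(** With [e = e_i], [poch (1+e) i] equals [(-1)^i poch (-e-i) i] by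
    reflection, and [poch (-e-i) i * poch (-e) (M-i) = poch (-e-i) M]. Since
    [-e-i] is affine in [1+a+i] with constant term [1+d], the sum is an
    instance of [altdiff_poch_div]. *)
Lemma convolution_identity (a c d : R) (M : nat) :
  -1 < a ->
  sum_f_R0 (fun i =>
     let e := INR (i + 1) * c + (a * (c + 1) - d) in
     poch (1 + e) i / (INR (fact i) * (INR (i + 1) + a))
     * (poch (- e) (M - i) / INR (fact (M - i)))) M
  = poch (1 + d) M / poch (1 + a) (S M).
Proof.
  intros Ha.
  rewrite <- (altdiff_poch_div M M (1 + d) (c + 1) (1 + a)) by (lra || lia).
  apply sum_eq. intros i Hi. cbv zeta.
  set (e := INR (i + 1) * c + (a * (c + 1) - d)).
  replace (1 + d - (c + 1) * (1 + a + INR i)) with (1 - (1 + e) - INR i)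
    by (unfold e; rewrite plus_INR; simpl; ring).
  replace (poch _ M) with (poch (1 - (1 + e) - INR i) (i + (M - i)))
    by (f_equal; lia).
  rewrite poch_add, poch_reflect.
  replace (1 - (1 + e) - INR i + INR i) with (- e) by ring.
  assert (Hsq : (-1) ^ i * (-1) ^ i = 1).
  { rewrite <- Rpow_mult_distr. replace (-1 * -1) with 1 by ring. apply pow1. }
  rewrite plus_INR. change (INR 1) with 1.
  pose proof (pos_INR i). pose proof (INR_fact_neq_0 i).
  pose proof (INR_fact_neq_0 (M - i)).
  transitivity (((-1) ^ i * (-1) ^ i) * (poch (1 + e) i / (INR (fact i) * (INR i + 1 + a)) *
    (poch (- e) (M - i) / INR (fact (M - i))))).
  - rewrite Hsq. ring.
  - field. repeat split; trivial; lra.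
Qed.

(** * Growth of the coefficients *)

(** The product [prod_(1 <= j <= N) |j - m|], for [m] close to [th N],
    behaves like [N! / binomial(N, th N)]. To bound it, remove a factor from
    one end of the product: the first factor has size about [th N] and
    removing it shifts [(N, m)] to [(N-1, m-1)]; the last has size about
    [(1-th) N] and removing it shifts [(N, m)] to [(N-1, m)]. Choosing the
    end by the sign of [m - th N] keeps [|m - th N|] below [B], and the
    accumulated relative errors [1 + D/N] are collected in the last
    Pochhammer symbol. *)
Lemma poch_growth (th B m : R) (N : nat) :
  0 < th < 1 -> 1 <= B -> Rabs (m - th * INR N) <= B ->
  Rabs (poch (1 - m) N)
  <= Rpower th (- B) * Rpower (1 - th) (- B)
     * (Rpower th m * Rpower (1 - th) (INR N - m))
     * poch (1 + (1 + B) / (th * (1 - th))) N.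
Proof.
  intros Hth HB. set (D := (1 + B) / (th * (1 - th))).
  assert (HD1 : 1 + B <= th * D).
  { unfold D. replace (th * _) with ((1 + B) / (1 - th)) by (field; lra).
    apply Rle_div_r; nra. }
  assert (HD2 : B <= (1 - th) * D).
  { unfold D. replace ((1 - th) * _) with ((1 + B) / th) by (field; lra).
    apply Rle_div_r; nra. }
  assert (HD : 0 < D) by nra.
  revert m. induction N as [|N IH]; intros m Hm.
  - simpl poch. simpl INR in *. rewrite Rabs_R1, Rmult_1_r.
    rewrite Rmult_0_r, Rminus_0_r in Hm. apply Rabs_le_between in Hm.
    replace (Rpower th (- B) * Rpower (1 - th) (- B)
             * (Rpower th m * Rpower (1 - th) (0 - m)))
      with (Rpower th (m + - B) * Rpower (1 - th) (0 - m + - B))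
      by (rewrite !Rpower_plus; ring).
    assert (Hge : forall x z, 0 < x < 1 -> z <= 0 -> 1 <= Rpower x z).
    { intros x z Hx Hz. assert (ln x < 0) by (rewrite <- ln_1; apply ln_increasing; lra).
      apply Rle_trans with (1 + z * ln x); [nra|apply exp_ineq1_le]. }
    rewrite <- (Rmult_1_l 1). apply Rmult_le_compat; try lra; apply Hge; lra.
  - pose proof (pos_INR N) as HN. rewrite S_INR in Hm |- *.
    pose proof (poch_pos (1 + D) N ltac:(lra)) as HP.
    assert (Hpos : forall x z, 0 < Rpower x z) by (intros; apply exp_pos).
    apply Rabs_le_between in Hm.
    set (K := Rpower th (- B) * Rpower (1 - th) (- B)) in *.
    destruct (Rle_dec (th * (INR N + 1)) m) as [Hle|Hgt].
    + rewrite poch_S_l. replace (1 - m + 1) with (1 - (m - 1)) by ring.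
      assert (Hm' : Rabs (m - 1 - th * INR N) <= B) by (apply Rabs_le; nra).
      specialize (IH _ Hm').
      rewrite Rabs_mult, Rmult_comm. simpl poch. rewrite <- !Rmult_assoc.
      replace (Rpower th m) with (Rpower th (m - 1) * th)
        by (rewrite <- (Rpower_1 th) at 2 by lra; rewrite <- Rpower_plus; f_equal; ring).
      replace (INR N + 1 - m) with (INR N - (m - 1)) by ring.
      apply Rle_trans with (K * (Rpower th (m - 1) * Rpower (1 - th) (INR N - (m - 1)))
        * poch (1 + D) N * (th * (1 + D + INR N))); [|right; ring].
      apply Rmult_le_compat; try apply Rabs_pos; try exact IH.
      apply Rabs_le; nra.
    + assert (Hm' : Rabs (m - th * INR N) <= B) by (apply Rabs_le; nra).
      specialize (IH _ Hm'). simpl poch. rewrite Rabs_mult.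
      replace (INR N + 1 - m) with ((INR N - m) + 1) by ring.
      rewrite Rpower_plus, (Rpower_1 (1 - th)) by lra.
      apply Rle_trans with (K * (Rpower th m * Rpower (1 - th) (INR N - m))
        * poch (1 + D) N * ((1 - th) * (1 + D + INR N))); [|right; ring].
      apply Rmult_le_compat; try apply Rabs_pos; try exact IH.
      apply Rabs_le; nra.
Qed.

Lemma is_lim_seq_ratio_shift (s : R) :
  is_lim_seq (fun n => (s + INR n) / (INR n + 1)) 1.
Proof.
  apply is_lim_seq_ext with (fun n => 1 + (s - 1) * / INR (S n)).
  { intros n. rewrite S_INR. pose proof (pos_INR n). field. lra. }
  replace (Finite 1) with (Rbar_plus 1 (Rbar_mult (s - 1) 0))
    by (simpl; f_equal; ring).
  apply is_lim_seq_plus'; [apply is_lim_seq_const|].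
  apply is_lim_seq_scal_l with (lu := Finite 0).
  apply (is_lim_seq_incr_1 (fun n => / INR n)).
  replace (Finite 0) with (Rbar_inv p_infty) by reflexivity.
  apply is_lim_seq_inv; [apply is_lim_seq_INR|discriminate].
Qed.

(** The absolute value only guarantees nonnegative terms, which makes the
    comparison with the larger parameter [|s| + 1] and the ratio test
    straightforward. *)
Lemma ex_series_poch (s q : R) :
  0 <= q < 1 -> ex_series (fun n => poch (Rabs s) n / INR (fact n) * q ^ n).
Proof.
  intros Hq.
  (* Both are positive: the ratio test requires nonzero terms. *)
  set (s' := Rabs s + 1). set (q' := (1 + q) / 2).
  assert (Hs' : 0 < s') by (unfold s'; pose proof (Rabs_pos s); lra).
  apply (ex_series_le (V := R_CompleteNormedModule) _
           (fun n => Rabs (poch s' n / INR (fact n) * q' ^ n))).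
  { intros n. unfold norm; simpl; unfold abs; simpl.
    rewrite !Rabs_mult.
    apply Rmult_le_compat; try apply Rabs_pos.
    - unfold Rdiv. rewrite !Rabs_mult. apply Rmult_le_compat_r; [apply Rabs_pos|].
      rewrite (Rabs_pos_eq (poch s' n)) by (left; apply poch_pos; lra).
      apply poch_abs_le. unfold s'. rewrite Rabs_Rabsolu. lra.
    - rewrite <- !RPow_abs. apply pow_incr. split; [apply Rabs_pos|].
      rewrite !Rabs_pos_eq; unfold q'; lra. }
  apply ex_series_DAlembert with q'.
  - unfold q'; lra.
  - intros n. pose proof (poch_pos s' n Hs'). pose proof (INR_fact_lt_0 n).
    assert (0 < q' ^ n) by (apply pow_lt; unfold q'; lra).
    apply Rgt_not_eq. apply Rmult_lt_0_compat; [apply Rdiv_lt_0_compat|]; lra.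
  - apply is_lim_seq_ext with (fun n => q' * ((s' + INR n) / (INR n + 1))).
    + intros n. rewrite fact_S_INR, <- tech_pow_Rmult. simpl poch.
      pose proof (poch_pos s' n Hs'). pose proof (INR_fact_lt_0 n).
      assert (0 < q' ^ n) by (apply pow_lt; unfold q'; lra).
      pose proof (pos_INR n).
      rewrite Rabs_pos_eq.
      * field. repeat split; lra.
      * assert (0 < q') by (unfold q'; lra).
        replace (_ / _) with (q' * ((s' + INR n) / (INR n + 1)))
          by (field; repeat split; lra).
        apply Rmult_le_pos; [lra|]. apply Rdiv_le_0_compat; lra.
    + replace (Finite q') with (Rbar_mult q' 1) by (simpl; f_equal; ring).
      apply is_lim_seq_scal_l with (lu := Finite 1), is_lim_seq_ratio_shift.
Qed.

(** * Complex series and diagonal rearrangement *)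

Local Notation Cis_series := (@is_series C_AbsRing C_NormedModule).
Local Notation Csum_n := (@sum_n C_AbelianMonoid).

Lemma Cis_series_Cmod (u : nat -> C) (l : C) :
  Cis_series u l <-> is_lim_seq (fun n => Cmod (Csum_n u n - l)%C) 0.
Proof.
  rewrite <- is_lim_seq_spec. unfold is_series.
  etransitivity.
  { apply (filterlim_locally_ball_norm (U := C_NormedModule)). }
  assert (E : forall (eps : R) n, Rabs (Cmod (Csum_n u n - l)%C - 0) < eps
     <-> Cmod (Csum_n u n - l)%C < eps).
  { intros eps n. rewrite Rminus_0_r, Rabs_pos_eq by apply Cmod_ge_0. tauto. }
  split; intros H eps; generalize (H eps); apply filter_imp; intros n Hn.
  - now apply E.
  - now apply E in Hn.
Qed.

Lemma is_lim_seq_le_0 (u v : nat -> R) :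
  (forall n, Rabs (u n) <= v n) -> is_lim_seq v 0 -> is_lim_seq u 0.
Proof.
  intros H Hv. apply is_lim_seq_abs_0.
  apply is_lim_seq_le_le with (fun _ => 0) v; trivial.
  - intros n. split; [apply Rabs_pos|apply H].
  - apply is_lim_seq_const.
Qed.

Lemma Csum_n_parts (u : nat -> C) (n : nat) :
  Csum_n u n = (sum_n (fun k => Re (u k)) n, sum_n (fun k => Im (u k)) n).
Proof.
  induction n as [|n IH].
  - rewrite !sum_O. now destruct (u O).
  - rewrite !sum_Sn, IH. now destruct (u (S n)).
Qed.

Lemma Cis_series_parts (u : nat -> C) (l : C) :
  Cis_series u l <->
  is_series (fun n => Re (u n)) (Re l) /\ is_series (fun n => Im (u n)) (Im l).
Proof.
  assert (H0 : forall (v : nat -> R) x, is_series v x <->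
            is_lim_seq (fun n => sum_n v n - x) 0).
  { intros v x. split; intros H.
    - replace (Finite 0) with (Finite (x - x)) by (f_equal; ring).
      apply is_lim_seq_minus'; [exact H|apply is_lim_seq_const].
    - change (is_lim_seq (sum_n v) x).
      apply (is_lim_seq_ext (fun n => (sum_n v n - x) + x)).
      { intros n. change (sum_n v n - x + x = sum_n v n). ring. }
      replace (Finite x) with (Finite (0 + x)) by (f_equal; ring).
      apply is_lim_seq_plus'; [exact H|apply is_lim_seq_const]. }
  rewrite Cis_series_Cmod, !H0. split.
  - intros H. split; revert H; apply is_lim_seq_le_0; intros n;
      rewrite Csum_n_parts.
    + etransitivity; [|apply Rmax_Cmod]. apply Rmax_l.
    + etransitivity; [|apply Rmax_Cmod]. apply Rmax_r.
  - intros [H1 H2]. apply is_lim_seq_abs_0 in H1, H2.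
    generalize (is_lim_seq_plus' _ _ _ _ H1 H2). rewrite Rplus_0_l.
    apply is_lim_seq_le_0. intros n.
    rewrite Rabs_pos_eq by apply Cmod_ge_0.
    rewrite Csum_n_parts. set (z := Cminus _ _).
    replace z with (RtoC (Re z) + Ci * RtoC (Im z))%C
      by (destruct z; unfold RtoC, Ci, Cplus, Cmult; simpl; f_equal; ring).
    apply Rle_trans with (1 := Cmod_triangle _ _).
    rewrite Cmod_mult, !Cmod_R. unfold Ci, Cmod at 1. simpl.
    replace (0 * (0 * 1) + 1 * (1 * 1)) with 1 by ring.
    rewrite sqrt_1, Rmult_1_l. apply Rle_refl.
Qed.

Lemma Cmod_Csum_n (u : nat -> C) (n : nat) :
  Cmod (Csum_n u n) <= sum_n (fun k => Cmod (u k)) n.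
Proof.
  induction n as [|n IH]; [rewrite !sum_O; apply Rle_refl|].
  rewrite !sum_Sn. apply Rle_trans with (1 := Cmod_triangle _ _).
  apply Rplus_le_compat_r, IH.
Qed.

Lemma Csum_n_minus (u v : nat -> C) (n : nat) :
  Csum_n (fun k => u k - v k)%C n = (Csum_n u n - Csum_n v n)%C.
Proof.
  induction n as [|n IH]; [now rewrite !sum_O|].
  rewrite !sum_Sn, IH. unfold plus; simpl. ring.
Qed.

(** Tannery's theorem: dominated convergence for series, with the number of
    terms growing together with the parameter. Split at a fixed [K]: the
    head is a finite sum of null sequences, the tail is controlled by [g]. *)
Lemma tannery (f : nat -> nat -> R) (g : nat -> R) :
  (forall M n, Rabs (f M n) <= g n) -> ex_series g ->
  (forall n, is_lim_seq (fun M => f M n) 0) ->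
  is_lim_seq (fun M => sum_n (f M) M) 0.
Proof.
  intros Hg [l Hl] Hf.
  assert (Hhead : forall K, is_lim_seq (fun M => sum_n (f M) K) 0).
  { induction K as [|K IH].
    - apply is_lim_seq_ext with (2 := Hf 0%nat). intros M. now rewrite sum_O.
    - apply is_lim_seq_ext with (fun M => sum_n (f M) K + f M (S K)).
      { intros M. now rewrite sum_Sn. }
      replace (Finite 0) with (Finite (0 + 0)) by (f_equal; ring).
      now apply is_lim_seq_plus'. }
  assert (Htail : forall M K p,
    Rabs (sum_n (f M) (K + p)) <= Rabs (sum_n (f M) K)
                                 + (sum_n g (K + p) - sum_n g K)).
  { intros M K p. induction p as [|p IH].
    - rewrite Nat.add_0_r. lra.
    - rewrite Nat.add_succ_r, !sum_Sn.
      specialize (Hg M (S (K + p))). unfold plus; simpl.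
      pose proof (Rabs_triang (sum_n (f M) (K + p)) (f M (S (K + p)))). lra. }
  rewrite <- is_lim_seq_spec. intros eps.
  assert (He : 0 < eps / 3) by (pose proof (cond_pos eps); lra).
  pose proof (proj2 (is_lim_seq_spec (sum_n g) l) Hl (mkposreal _ He)) as [K HK].
  pose proof (proj2 (is_lim_seq_spec _ _) (Hhead K) (mkposreal _ He)) as [M0 HM].
  exists (max K M0). intros M HMmax. simpl in HK, HM.
  specialize (HM M ltac:(lia)). pose proof (HK M ltac:(lia)) as H1.
  pose proof (HK K ltac:(lia)) as H2. specialize (Htail M K (M - K)%nat).
  replace (K + (M - K))%nat with M in Htail by lia.
  rewrite Rminus_0_r in HM |- *.
  apply Rabs_def2 in H1, H2. lra.
Qed.

(** Both sides sum over the triangle [n + k <= M]. *)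
Lemma diagonal_sum (A : nat -> nat -> C) (M : nat) :
  Csum_n (fun N => Csum_n (fun i => A i (N - i)%nat) N) M
  = Csum_n (fun n => Csum_n (A n) (M - n)) M.
Proof.
  induction M as [|M IH]; [now rewrite !sum_O|].
  rewrite sum_Sn, IH, !(sum_Sn _ M), Nat.sub_diag, sum_O.
  rewrite plus_assoc. f_equal. rewrite <- sum_n_plus.
  apply sum_n_ext_loc. intros n Hn.
  rewrite Nat.sub_succ_l by exact Hn. now rewrite sum_Sn.
Qed.

(** By [diagonal_sum], the partial sums of the diagonal series and of the
    row series differ by a sum of row remainders; each remainder tends to 0
    and is at most [2 B n], so [tannery] applies. *)
Lemma diagonal_rearrangement (A : nat -> nat -> C) (row : nat -> C) (B : nat -> R) :
  (forall n, Cis_series (A n) (row n)) ->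
  (forall n m, sum_n (fun k => Cmod (A n k)) m <= B n) ->
  ex_series B ->
  exists l, Cis_series row l
    /\ Cis_series (fun N => Csum_n (fun i => A i (N - i)%nat) N) l.
Proof.
  intros Hrow HB HsB.
  assert (Hpart : forall n m, Cmod (Csum_n (A n) m) <= B n).
  { intros n m. eapply Rle_trans; [apply Cmod_Csum_n|apply HB]. }
  assert (Hrem : forall n,
    is_lim_seq (fun m => Cmod (Csum_n (A n) m - row n)%C) 0).
  { intros n. apply Cis_series_Cmod, Hrow. }
  assert (HrowB : forall n, Cmod (row n) <= B n).
  { intros n.
    assert (H : is_lim_seq (fun m => B n + Cmod (Csum_n (A n) m - row n)%C) (B n)).
    { replace (Finite (B n)) with (Finite (B n + 0)) by (f_equal; ring).
      apply is_lim_seq_plus'; [apply is_lim_seq_const|apply Hrem]. }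
    apply (is_lim_seq_le (fun _ => Cmod (row n)) _ (Cmod (row n)) (B n))
      with (3 := H); [|apply is_lim_seq_const].
    intros m. specialize (Hpart n m).
    replace (row n) with (Csum_n (A n) m + - (Csum_n (A n) m - row n))%C at 1 by ring.
    apply Rle_trans with (1 := Cmod_triangle _ _). rewrite Cmod_opp. lra. }
  destruct (ex_series_le (V := C_CompleteNormedModule) row B HrowB HsB) as [l Hl].
  exists l. split; [exact Hl|].
  pose proof (tannery (fun M n => Cmod (Csum_n (A n) (M - n) - row n)%C)
                (fun n => 2 * B n)) as HT.
  cbv beta in HT.
  assert (H1 : is_lim_seq (fun M => sum_n (fun n =>
             Cmod (Csum_n (A n) (M - n) - row n)%C) M) 0).
  { apply HT.
    - intros M n. rewrite Rabs_pos_eq by apply Cmod_ge_0.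
      apply Rle_trans with (1 := Cmod_triangle _ _). rewrite Cmod_opp.
      specialize (Hpart n (M - n)%nat). specialize (HrowB n). lra.
    - apply (ex_series_scal (V := R_NormedModule) 2 B HsB).
    - intros n. apply (is_lim_seq_incr_n _ n).
      apply is_lim_seq_ext with (2 := Hrem n). intros M. do 3 f_equal. lia. }
  apply Cis_series_Cmod in Hl. apply Cis_series_Cmod.
  generalize (is_lim_seq_plus' _ _ _ _ H1 Hl). rewrite Rplus_0_l.
  apply is_lim_seq_le_0. intros M. rewrite Rabs_pos_eq by apply Cmod_ge_0.
  rewrite diagonal_sum.
  pose proof (Cmod_Csum_n (fun n => Csum_n (A n) (M - n) - row n)%C M) as Hs.
  rewrite Csum_n_minus in Hs.
  match goal with |- Cmod (?x - _)%C <= _ =>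
    replace (x - l)%C with ((x - Csum_n row M) + (Csum_n row M - l))%C by ring end.
  apply Rle_trans with (1 := Cmod_triangle _ _).
  apply Rplus_le_compat_r. exact Hs.
Qed.

(** * The complex binomial series *)

(** In the right half-plane, which contains [1 - t] for [|t| < 1], the
    arctangent form makes the argument easy to differentiate. *)
Lemma Carg_atan (z : C) : 0 < Re z -> Carg z = atan (Im z / Re z).
Proof.
  intros Hz. destruct z as [x y]. unfold Carg, Cmod. simpl in *.
  set (r := sqrt _).
  assert (Hr2 : r * r = x * x + y * y) by (unfold r; rewrite sqrt_sqrt; nra).
  assert (Hr : 0 < r) by (apply sqrt_lt_R0; nra).
  rewrite acos_atan by (apply Rdiv_lt_0_compat; lra).
  replace (1 - (x / r)²) with ((y / r)²).
  2: { unfold Rsqr. replace (y / r * (y / r)) with (y * y / (r * r)) by (field; lra).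
       replace (y * y) with (r * r - x * x) by lra. field. lra. }
  rewrite sqrt_Rsqr_abs.
  replace (Rabs (y / r)) with (Rabs y / r)
    by (rewrite Rabs_div, (Rabs_pos_eq r); lra).
  destruct (Rle_dec 0 y) as [p|n].
  - rewrite Rabs_pos_eq by lra. f_equal. field. lra.
  - apply Rnot_le_lt in n. rewrite Rabs_left by lra.
    rewrite <- atan_opp. f_equal. field. lra.
Qed.

Lemma Cpower_real (z : C) (e : R) :
  Cpower z (RtoC e)
  = (exp (e * ln (Cmod z)) * cos (e * Carg z), exp (e * ln (Cmod z)) * sin (e * Carg z)).
Proof.
  unfold Cpower, Cexp, Clog. simpl.
  now rewrite !Rmult_0_l, Rminus_0_r, Rplus_0_r.
Qed.

Lemma Cpower_plus (z : C) (e f : R) :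
  Cpower z (RtoC (e + f)) = (Cpower z (RtoC e) * Cpower z (RtoC f))%C.
Proof.
  rewrite !Cpower_real, !Rmult_plus_distr_r, exp_plus, cos_plus, sin_plus.
  unfold Cmult; simpl. f_equal; ring.
Qed.

Lemma Cpower_0 (z : C) : Cpower z (RtoC 0) = RtoC 1.
Proof.
  rewrite Cpower_real, !Rmult_0_l, exp_0, cos_0, sin_0.
  unfold RtoC. f_equal; ring.
Qed.

Lemma Cpower_INR (z : C) (e : R) (n : nat) :
  Cpower z (RtoC (INR n * e)) = (Cpower z (RtoC e) ^ n)%C.
Proof.
  induction n as [|n IH].
  - rewrite Rmult_0_l. apply Cpower_0.
  - rewrite S_INR, Rmult_plus_distr_r, Rmult_1_l, Cpower_plus, IH.
    rewrite Cpow_S. apply Cmult_comm.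
Qed.

Lemma Cpower_pos (r e : R) : 0 < r -> Cpower (RtoC r) (RtoC e) = RtoC (Rpower r e).
Proof.
  intros Hr. rewrite Cpower_real, Carg_atan, Cmod_R by exact Hr.
  simpl. unfold Rdiv. rewrite Rmult_0_l, atan_0, Rmult_0_r, cos_0, sin_0.
  rewrite Rabs_pos_eq by lra. unfold RtoC, Rpower. f_equal; ring.
Qed.

(** Write [t = x + i y] and [Z = F + i G]. The hypotheses are the real and
    imaginary parts of [(1 - s t) Z' = - e t Z], the equation satisfied by
    [(1 - s t)^e] on the segment from 0 to [t]. Hence [Z] times [exp (- e
    Log (1 - s t))] has derivative 0 and stays equal to 1. *)
Lemma power_ode (x y e : R) (F G f g : R -> R) :
  x < 1 ->
  (forall s, 0 <= s <= 1 -> is_derive F s (f s)) ->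
  (forall s, 0 <= s <= 1 -> is_derive G s (g s)) ->
  (forall s, 0 <= s <= 1 ->
     (1 - s * x) * f s + s * y * g s = - e * (x * F s - y * G s)) ->
  (forall s, 0 <= s <= 1 ->
     (1 - s * x) * g s - s * y * f s = - e * (y * F s + x * G s)) ->
  F 0 = 1 -> G 0 = 0 ->
  (F 1, G 1) = Cpower (1 - (x, y))%C (RtoC e).
Proof.
  intros Hx HF HG H1 H2 HF0 HG0.
  set (m := fun s => (1 - s * x) * (1 - s * x) + s * y * (s * y)).
  set (l1 := fun s => / 2 * ln (m s)).
  set (l2 := fun s => atan (- (s * y) / (1 - s * x))).
  assert (Hre : forall s, 0 <= s <= 1 -> 0 < 1 - s * x) by
    (intros s Hs; destruct (Rle_or_lt x 0); nra).
  assert (Hm : forall s, 0 <= s <= 1 -> 0 < m s).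
  { intros s Hs. specialize (Hre s Hs). unfold m. nra. }
  assert (Dl1 : forall s, 0 <= s <= 1 ->
    is_derive l1 s ((- x * (1 - s * x) + s * y * y) / m s)).
  { intros s Hs. specialize (Hm s Hs). unfold l1. unfold m in *.
    auto_derive; [exact Hm|]. field. lra. }
  assert (Dl2 : forall s, 0 <= s <= 1 -> is_derive l2 s (- y / m s)).
  { intros s Hs. specialize (Hm s Hs). specialize (Hre s Hs). unfold l2, m in *.
    auto_derive; [lra|]. unfold Rsqr. field.
    repeat split; try lra. }
  (* Real and imaginary parts of [Z exp (- e Log (1 - s t))]. *)
  set (W1 := fun s => exp (- e * l1 s) * (F s * cos (e * l2 s) + G s * sin (e * l2 s))).
  set (W2 := fun s => exp (- e * l1 s) * (G s * cos (e * l2 s) - F s * sin (e * l2 s))).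
  (* Cramer's rule for the two hypotheses, whose determinant is [m s]. *)
  assert (Df : forall s, 0 <= s <= 1 ->
     f s = - e * ((1 - s * x) * (x * F s - y * G s) - s * y * (y * F s + x * G s)) / m s
     /\ g s = - e * (s * y * (x * F s - y * G s) + (1 - s * x) * (y * F s + x * G s)) / m s).
  { intros s Hs. specialize (Hm s Hs). specialize (H1 s Hs). specialize (H2 s Hs).
    split; apply Rmult_eq_reg_r with (m s); try lra;
      unfold Rdiv; rewrite Rmult_assoc, Rinv_l, Rmult_1_r by lra; unfold m.
    - transitivity ((1 - s * x) * ((1 - s * x) * f s + s * y * g s)
                    - s * y * ((1 - s * x) * g s - s * y * f s)); [ring|].
      rewrite H1, H2. ring.
    - transitivity (s * y * ((1 - s * x) * f s + s * y * g s)
                    + (1 - s * x) * ((1 - s * x) * g s - s * y * f s)); [ring|].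
      rewrite H1, H2. ring. }
  assert (DW : forall s, 0 <= s <= 1 -> is_derive W1 s 0 /\ is_derive W2 s 0).
  { intros s Hs.
    pose proof (HF s Hs) as DF. pose proof (HG s Hs) as DG.
    pose proof (Dl1 s Hs) as D1. pose proof (Dl2 s Hs) as D2.
    destruct (Df s Hs) as [Ef Eg]. pose proof (Hm s Hs) as Hms.
    assert (X : ex_derive F s /\ ex_derive G s /\ ex_derive l1 s /\ ex_derive l2 s)
      by (repeat split; eexists; eassumption).
    destruct X as (XF & XG & X1 & X2).
    split; unfold W1, W2; auto_derive; try tauto;
      replace (Derive (fun z => F z) s) with (f s) by (symmetry; now apply is_derive_unique);
      replace (Derive (fun z => G z) s) with (g s) by (symmetry; now apply is_derive_unique);
      replace (Derive (fun z => l1 z) s) with ((- x * (1 - s * x) + s * y * y) / m s)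
        by (symmetry; now apply is_derive_unique);
      replace (Derive (fun z => l2 z) s) with (- y / m s)
        by (symmetry; now apply is_derive_unique);
      rewrite Ef, Eg; field; lra. }
  assert (E1 : W1 0 = W1 1)
    by (apply (eq_is_derive W1); [intros s Hs; now apply DW|lra]).
  assert (E2 : W2 0 = W2 1)
    by (apply (eq_is_derive W2); [intros s Hs; now apply DW|lra]).
  assert (L1 : l1 0 = 0).
  { unfold l1, m. rewrite !Rmult_0_l, Rminus_0_r, Rplus_0_r, Rmult_1_l, ln_1. ring. }
  assert (L2 : l2 0 = 0).
  { unfold l2. rewrite !Rmult_0_l, Ropp_0. unfold Rdiv. now rewrite Rmult_0_l, atan_0. }
  unfold W1 in E1. unfold W2 in E2.
  rewrite L1, L2, HF0, HG0, !Rmult_0_r, exp_0, cos_0, sin_0 in E1, E2.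
  assert (Hl1 : ln (Cmod (1 - (x, y))%C) = l1 1).
  { unfold l1. specialize (Hm 1 ltac:(lra)). unfold Cmod.
    simpl. replace (_ + _) with (m 1) by (unfold m; ring).
    rewrite <- Rpower_sqrt by exact Hm. unfold Rpower. now rewrite ln_exp. }
  assert (Hl2 : Carg (1 - (x, y))%C = l2 1).
  { rewrite Carg_atan by (simpl; lra). unfold l2. simpl. f_equal. f_equal; ring. }
  rewrite Cpower_real, Hl1, Hl2.
  assert (Hexp : exp (e * l1 1) * exp (- e * l1 1) = 1).
  { rewrite <- exp_plus, <- exp_0. f_equal. ring. }
  pose proof (sin2_cos2 (e * l2 1)) as Hsc. unfold Rsqr in Hsc.
  set (E := exp (e * l1 1)) in *. set (E' := exp (- e * l1 1)) in *.
  set (cc := cos _) in *. set (ss := sin _) in *.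
  f_equal.
  - transitivity ((E * E') * (ss * ss + cc * cc) * F 1);
      [rewrite Hexp, Hsc; ring|].
    transitivity (E * (cc * (E' * (F 1 * cc + G 1 * ss)) - ss * (E' * (G 1 * cc - F 1 * ss))));
      [ring|]. rewrite <- E1, <- E2. ring.
  - transitivity ((E * E') * (ss * ss + cc * cc) * G 1);
      [rewrite Hexp, Hsc; ring|].
    transitivity (E * (ss * (E' * (F 1 * cc + G 1 * ss)) + cc * (E' * (G 1 * cc - F 1 * ss))));
      [ring|]. rewrite <- E1, <- E2. ring.
Qed.

(** The coefficient of [t^k] in [(1 - t)^e]. *)
Definition binom_coef (e : R) (k : nat) : R := poch (- e) k / INR (fact k).

Lemma binom_coef_S (e : R) (k : nat) :
  INR (S k) * binom_coef e (S k) = (INR k - e) * binom_coef e k.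
Proof.
  unfold binom_coef. rewrite fact_S_INR, S_INR. simpl poch.
  pose proof (pos_INR k). pose proof (INR_fact_neq_0 k).
  field. split; trivial; lra.
Qed.

Lemma binom_coef_abs_le (e s : R) (k : nat) :
  Rabs e <= s -> Rabs (binom_coef e k) <= poch s k / INR (fact k).
Proof.
  intros He. pose proof (INR_fact_lt_0 k).
  unfold binom_coef, Rdiv. rewrite Rabs_mult.
  rewrite (Rabs_pos_eq (/ _)) by (left; now apply Rinv_0_lt_compat).
  apply Rmult_le_compat_r; [left; now apply Rinv_0_lt_compat|].
  apply poch_abs_le. now rewrite Rabs_Ropp.
Qed.

(** Stated for weights [w], to be used with the real and imaginary parts of
    [t^k]: the strict inequality gives differentiability up to and including
    the endpoint 1 of the segment. *)
Lemma CV_radius_binomial (e r : R) (w : nat -> R) :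
  0 <= r < 1 -> (forall k, Rabs (w k) <= r ^ k) ->
  Rbar_lt 1 (CV_radius (fun k => binom_coef e k * w k)).
Proof.
  intros Hr Hw.
  (* Any [rho > 1] with [r rho < 1] would do. *)
  set (rho := 2 / (1 + r)).
  assert (Hrho : 1 < rho) by (apply Rlt_div_r; lra).
  apply Rbar_lt_le_trans with rho; [exact Hrho|].
  apply (proj1 (Lub_Rbar_correct (CV_disk _))).
  assert (Hq : 0 <= r * rho < 1).
  { split; [apply Rmult_le_pos; lra|].
    unfold rho. replace (r * (2 / (1 + r))) with (2 * r / (1 + r)) by (field; lra).
    apply Rlt_div_l; lra. }
  eapply (ex_series_le (V := R_CompleteNormedModule)); [|apply (ex_series_poch e _ Hq)].
  intros k. unfold norm; simpl; unfold abs; simpl.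
  rewrite Rabs_Rabsolu, !Rabs_mult, Rpow_mult_distr, <- Rmult_assoc.
  rewrite (Rabs_pos_eq (rho ^ k)) by (apply pow_le; lra).
  apply Rmult_le_compat_r; [apply pow_le; lra|].
  apply Rmult_le_compat; try apply Rabs_pos; [|apply Hw].
  apply binom_coef_abs_le, Rle_refl.
Qed.

(** The operator [s d/ds - e] multiplies the coefficient of [s^k] by [k -
    e]. *)
Lemma is_series_euler (w : nat -> R) (e s : R) :
  Rbar_lt (Rabs s) (CV_radius w) ->
  is_series (fun k => (INR k - e) * w k * s ^ k)
    (s * PSeries (PS_derive w) s - e * PSeries w s).
Proof.
  intros Hs.
  assert (H1 : is_series (fun k => PS_incr_1 (PS_derive w) k * s ^ k)
                 (s * PSeries (PS_derive w) s)).
  { apply is_pseries_R. apply (is_pseries_incr_1 (PS_derive w) s).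
    apply PSeries_correct. now apply ex_pseries_derive. }
  assert (H2 : is_series (fun k => w k * s ^ k) (PSeries w s)).
  { apply is_pseries_R, PSeries_correct. now apply CV_radius_inside. }
  apply (is_series_scal_l e) in H2.
  generalize (is_series_minus _ _ _ _ H1 H2). apply is_series_ext.
  intros [|k].
  - change (0 * s ^ 0 + - (e * (w O * s ^ 0)) = (INR 0 - e) * w O * s ^ 0).
    simpl. ring.
  - change (INR (S k) * w (S k) * s ^ S k + - (e * (w (S k) * s ^ S k))
            = (INR (S k) - e) * w (S k) * s ^ S k). ring.
Qed.

(** With [t] fixed, the real and imaginary parts of the series at [s t] are
    real power series in [s]; the recurrence [binom_coef_S] is the
    differential equation of [power_ode]. *)
Lemma binomial_series (t : C) (e : R) :
  Cmod t < 1 ->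
  Cis_series (fun k => RtoC (binom_coef e k) * t ^ k)%C (Cpower (1 - t) (RtoC e)).
Proof.
  intros Ht.
  set (fr := fun k => binom_coef e k * Re (t ^ k)%C).
  set (fi := fun k => binom_coef e k * Im (t ^ k)%C).
  assert (Hr : 0 <= Cmod t < 1) by (split; [apply Cmod_ge_0|exact Ht]).
  assert (Rr : Rbar_lt 1 (CV_radius fr)).
  { apply CV_radius_binomial with (1 := Hr). intros k. rewrite <- Cmod_pow.
    apply re_le_Cmod. }
  assert (Ri : Rbar_lt 1 (CV_radius fi)).
  { apply CV_radius_binomial with (1 := Hr). intros k. rewrite <- Cmod_pow.
    etransitivity; [|apply Rmax_Cmod]. apply Rmax_r. }
  assert (Hin : forall (w : nat -> R) s, 0 <= s <= 1 -> Rbar_lt 1 (CV_radius w) ->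
           Rbar_lt (Rabs s) (CV_radius w)).
  { intros w s Hs Hw. apply Rbar_le_lt_trans with 1; [|exact Hw].
    simpl. rewrite Rabs_pos_eq; lra. }
  rewrite Cis_series_parts.
  assert (H01 : 0 <= 1 <= 1) by lra.
  destruct t as [x y].
  assert (HE : (PSeries fr 1, PSeries fi 1) = Cpower (1 - (x, y))%C (RtoC e)).
  { apply power_ode with (PSeries (PS_derive fr)) (PSeries (PS_derive fi)).
    - apply Rle_lt_trans with (2 := Ht). apply Rle_trans with (Rabs x); [apply Rle_abs|].
      apply (re_le_Cmod (x, y)).
    - intros s Hs. apply is_derive_PSeries. now apply Hin.
    - intros s Hs. apply is_derive_PSeries. now apply Hin.
    - intros s Hs.
      enough (H : PSeries (PS_derive fr) s
        = x * (s * PSeries (PS_derive fr) s - e * PSeries fr s)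
          - y * (s * PSeries (PS_derive fi) s - e * PSeries fi s)) by lra.
      apply is_series_unique.
      generalize (is_series_minus _ _ _ _
        (is_series_scal_l x _ _ (is_series_euler fr e s (Hin _ _ Hs Rr)))
        (is_series_scal_l y _ _ (is_series_euler fi e s (Hin _ _ Hs Ri)))).
      apply is_series_ext. intros k. unfold PS_derive, fr, fi. rewrite Cpow_S.
      set (z := ((x, y) ^ k)%C).
      change (x * ((INR k - e) * (binom_coef e k * Re z) * s ^ k)
              + - (y * ((INR k - e) * (binom_coef e k * Im z) * s ^ k))
              = INR (S k) * (binom_coef e (S k) * (x * Re z - y * Im z)) * s ^ k).
      rewrite <- (Rmult_assoc (INR (S k))), binom_coef_S. ring.
    - intros s Hs.
      enough (H : PSeries (PS_derive fi) s
        = y * (s * PSeries (PS_derive fr) s - e * PSeries fr s)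
          + x * (s * PSeries (PS_derive fi) s - e * PSeries fi s)) by lra.
      apply is_series_unique.
      generalize (is_series_plus _ _ _ _
        (is_series_scal_l y _ _ (is_series_euler fr e s (Hin _ _ Hs Rr)))
        (is_series_scal_l x _ _ (is_series_euler fi e s (Hin _ _ Hs Ri)))).
      apply is_series_ext. intros k. unfold PS_derive, fr, fi. rewrite Cpow_S.
      set (z := ((x, y) ^ k)%C).
      change (y * ((INR k - e) * (binom_coef e k * Re z) * s ^ k)
              + (x * ((INR k - e) * (binom_coef e k * Im z) * s ^ k))
              = INR (S k) * (binom_coef e (S k) * (x * Im z + y * Re z)) * s ^ k).
      rewrite <- (Rmult_assoc (INR (S k))), binom_coef_S. ring.
    - rewrite PSeries_0. unfold fr, binom_coef. simpl. field.
    - rewrite PSeries_0. unfold fi, binom_coef. simpl. field. }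
  rewrite <- HE. split.
  - apply is_series_ext with (fun k => fr k * 1 ^ k).
    + intros k. unfold fr. rewrite pow1, Rmult_1_r.
      destruct ((x, y) ^ k)%C. simpl. ring.
    + apply is_pseries_R, PSeries_correct, CV_radius_inside, Hin; trivial.
  - apply is_series_ext with (fun k => fi k * 1 ^ k).
    + intros k. unfold fi. rewrite pow1, Rmult_1_r.
      destruct ((x, y) ^ k)%C. simpl. ring.
    + apply is_pseries_R, PSeries_correct, CV_radius_inside, Hin; trivial.
Qed.

(** * The double series of the theorem *)

(** For [s >= 0] the series of [(1 - x)^(-s)] has nonnegative terms, so
    partial sums stay below the limit. *)
Lemma binomial_partial_sum_le (s x : R) (m : nat) :
  0 <= s -> 0 <= x < 1 ->
  sum_n (fun k => poch s k / INR (fact k) * x ^ k) m <= Rpower (1 - x) (- s).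
Proof.
  intros Hs Hx.
  assert (H : is_series (fun k => poch s k / INR (fact k) * x ^ k) (Rpower (1 - x) (- s))).
  { assert (Hc : Cmod (RtoC x) < 1) by (rewrite Cmod_R, Rabs_pos_eq; lra).
    generalize (binomial_series (RtoC x) (- s) Hc).
    replace (1 - RtoC x)%C with (RtoC (1 - x)) by apply RtoC_minus.
    rewrite Cpower_pos, Cis_series_parts by lra.
    intros [H _]. revert H. apply is_series_ext. intros k.
    rewrite <- RtoC_pow, <- RtoC_mult. unfold binom_coef. now rewrite Ropp_involutive. }
  apply (is_lim_seq_incr_compare _ _ H). intros n. rewrite sum_Sn.
  unfold plus; simpl.
  assert (0 <= poch s (S n) / INR (fact (S n)) * x ^ S n).
  { apply Rmult_le_pos; [|now apply pow_le].
    apply Rdiv_le_0_compat; [|apply INR_fact_lt_0].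
    apply Rle_trans with (2 := poch_abs_le s s (S n) ltac:(rewrite Rabs_pos_eq; lra)).
    apply Rabs_pos. }
  simpl in *. lra.
Qed.

Lemma Rpower_INR_mult (z w : R) (n : nat) : Rpower z (INR n * w) = Rpower z w ^ n.
Proof.
  rewrite Rmult_comm, <- Rpower_mult, Rpower_pow; [reflexivity|apply exp_pos].
Qed.

Definition shift_exp (a c d : R) : R := a * (c + 1) - d.

(** The factor [(1 - t)^(a (c+1) - d)] in front of the right-hand series is
    absorbed in the rows, so this is the full exponent of [1 - t] in row
    [n]. Rows are indexed from 0, hence the shift [n + 1]. *)
Definition row_exp (a c d : R) (n : nat) : R := INR (n + 1) * c + shift_exp a c d.
Definition row_coef (a c d : R) (n : nat) : R :=
  poch (1 + row_exp a c d n) n / (INR (fact n) * (INR (n + 1) + a)).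

(** With [th = - c], [poch_growth] at [m = (n+1) th - shift_exp] bounds the
    terms by a constant times [poch D n / n! * q^n], where [q = x
    (1-x)^(-th) th^th (1-th)^(1-th)]; the hypothesis on [x] is [q < 1]. *)
Lemma ex_series_majorant (a c d x : R) :
  -1 < c < 0 -> -1 < a -> 0 <= x < 1 ->
  x * Rpower (1 - x) c < Rpower (Rabs c) c / Rpower (c + 1) (c + 1) ->
  ex_series (fun n => Rabs (row_coef a c d n) * x ^ n
    * Rpower (1 - x) (- (INR (n + 1) * (- c) + Rabs (shift_exp a c d)))).
Proof.
  intros Hc Ha Hx Hxc. set (E := Rabs (shift_exp a c d)).
  assert (HE : 0 <= E) by apply Rabs_pos.
  set (th := - c). replace c with (- th) in Hxc by (unfold th; ring).
  assert (Hth : 0 < th < 1) by (unfold th; lra).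
  rewrite Rabs_Ropp, Rabs_pos_eq in Hxc by lra.
  set (q := x * Rpower (1 - x) (- th) * Rpower th th * Rpower (1 - th) (1 - th)).
  assert (Hpos : forall u v, 0 < Rpower u v) by (intros; apply exp_pos).
  assert (Hq : 0 <= q < 1).
  { split.
    - repeat apply Rmult_le_pos; try (left; apply Hpos); lra.
    - replace (- th + 1) with (1 - th) in Hxc by ring.
      apply Rlt_div_r in Hxc; [|apply Hpos].
      rewrite (Rpower_Ropp th) in Hxc.
      apply Rmult_lt_compat_r with (r := Rpower th th) in Hxc; [|apply Hpos].
      rewrite Rinv_l in Hxc by (apply Rgt_not_eq, Hpos).
      unfold q. lra. }
  set (D := 1 + (1 + (1 + E)) / (th * (1 - th))).
  set (K := Rpower th (- (1 + E)) * Rpower (1 - th) (- (1 + E))).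
  set (L := K / (1 + a) * (Rpower (1 - x) (- th - E)
              * Rpower th (th - shift_exp a c d) * Rpower (1 - th) (shift_exp a c d - th))).
  apply (ex_series_le (V := R_CompleteNormedModule) _
           (fun n => L * (poch (Rabs D) n / INR (fact n) * q ^ n))).
  2: { apply (ex_series_scal (V := R_NormedModule) L). now apply ex_series_poch. }
  intros n. unfold norm; simpl; unfold abs; simpl.
  rewrite Rabs_pos_eq.
  2: { apply Rmult_le_pos; [|left; apply Hpos].
       apply Rmult_le_pos; [apply Rabs_pos|apply pow_le; lra]. }
  set (m := INR (n + 1) * th - shift_exp a c d).
  assert (Hm : Rabs (m - th * INR n) <= 1 + E).
  { unfold m. rewrite plus_INR. simpl INR.
    replace (_ - _) with (th - shift_exp a c d) by ring.
    pose proof (Rabs_triang th (- shift_exp a c d)) as H. rewrite Rabs_Ropp in H.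
    rewrite (Rabs_pos_eq th) in H by lra. fold E in H. unfold Rminus. lra. }
  pose proof (poch_growth th (1 + E) m n Hth ltac:(lra) Hm) as HG.
  fold D K in HG.
  assert (HD : 0 < D).
  { unfold D. assert (0 < (1 + (1 + E)) / (th * (1 - th)))
      by (apply Rdiv_lt_0_compat; nra). lra. }
  rewrite (Rabs_pos_eq D) by lra.
  pose proof (pos_INR n) as Hn. pose proof (INR_fact_lt_0 n) as Hf.
  assert (Hb : Rabs (row_coef a c d n)
    <= K * (Rpower th m * Rpower (1 - th) (INR n - m)) * poch D n
       / (INR (fact n) * (1 + a))).
  { unfold row_coef. unfold Rdiv at 1. rewrite Rabs_mult.
    rewrite plus_INR. simpl (INR 1).
    rewrite (Rabs_pos_eq (/ _)).
    2: { left. apply Rinv_0_lt_compat, Rmult_lt_0_compat; lra. }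
    apply Rmult_le_compat; try apply Rabs_pos.
    - left. apply Rinv_0_lt_compat, Rmult_lt_0_compat; lra.
    - replace (1 + row_exp a c d n) with (1 - m); [exact HG|].
      unfold m, row_exp, th. ring.
    - apply Rinv_le_contravar; [apply Rmult_lt_0_compat; lra|].
      apply Rmult_le_compat_l; lra. }
  apply Rle_trans with
    (K * (Rpower th m * Rpower (1 - th) (INR n - m)) * poch D n
       / (INR (fact n) * (1 + a)) * (x ^ n * Rpower (1 - x) (- (INR (n + 1) * th + E)))).
  { rewrite Rmult_assoc. apply Rmult_le_compat_r; [|exact Hb].
    apply Rmult_le_pos; [apply pow_le; lra|left; apply Hpos]. }
  right.
  replace m with (INR n * th + (th - shift_exp a c d))
    by (unfold m; rewrite plus_INR; simpl; ring).
  replace (INR n - _) with (INR n * (1 - th) + (shift_exp a c d - th)) by ring.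
  replace (- (INR (n + 1) * th + E)) with (INR n * (- th) + (- th - E))
    by (rewrite plus_INR; simpl; ring).
  rewrite !(Rpower_plus (INR n * _)), !Rpower_INR_mult.
  unfold L, q. rewrite !Rpow_mult_distr. field. lra.
Qed.

(** The diagonal sums are [convolution_identity]; the symbol [(1)_N] cancels
    [N!], and [(1+a)_(N+1) = (1+a) (2+a)_N]. *)
Lemma row_diagonal_term (a c d : R) (t : C) (N : nat) :
  -1 < a ->
  Csum_n (fun i => RtoC (row_coef a c d i) * t ^ i
            * (RtoC (binom_coef (row_exp a c d i) (N - i)) * t ^ (N - i)))%C N
  = (RtoC (/ (1 + a))
     * hyp2F1_term (RtoC 1) (RtoC (1 + d)) (RtoC (2 + a)) t N)%C :> C.
Proof.
  intros Ha.
  transitivity (RtoC (sum_f_R0 (fun i =>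
                  row_coef a c d i * binom_coef (row_exp a c d i) (N - i))%R N)
                * t ^ N)%C.
  { set (f := fun i => row_coef a c d i * binom_coef (row_exp a c d i) (N - i)).
    transitivity (Csum_n (fun i => RtoC (f i) * t ^ N)%C N).
    - apply sum_n_ext_loc. intros i Hi.
      replace (t ^ N)%C with (t ^ i * t ^ (N - i))%C
        by (rewrite <- Cpow_add_r; f_equal; lia).
      unfold f. rewrite RtoC_mult.
      match goal with |- ?u = ?v => change (@eq C u v) end. ring.
    - generalize (t ^ N)%C. intros z. clearbody f. generalize N. intros M.
      induction M as [|M IH]; [now rewrite sum_O|].
      rewrite sum_Sn, IH, tech5, RtoC_plus. unfold plus; simpl. ring. }
  pose proof (convolution_identity a c d N Ha) as H.
  change (sum_f_R0 (fun i => row_coef a c d i * binom_coef (row_exp a c d i) (N - i)) N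
    = poch (1 + d) N / poch (1 + a) (S N)) in H.
  rewrite H. unfold hyp2F1_term. rewrite !Cpochhammer_RtoC.
  rewrite poch_1, poch_S_l. replace (1 + a + 1) with (2 + a) by ring.
  pose proof (poch_pos (2 + a) N ltac:(lra)). pose proof (INR_fact_neq_0 N).
  replace (poch (1 + d) N / _) with (/ (1 + a) * (poch (1 + d) N / poch (2 + a) N))
    by (field; lra).
  rewrite RtoC_mult, (RtoC_div (poch _ _)) by lra.
  field. split; intros Z; apply RtoC_inj in Z; lra.
Qed.

Theorem mainTheorem13 (a c d : R) (t : C)
    (hc : -1 < c < 0) (ha : -1 < a < 1)
    (ht : Cmod t < 1)
    (htc : Cmod t * Rpower (1 - Cmod t) c
           < Rpower (Rabs c) c / Rpower (c + 1) (c + 1)) :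
  @ex_series C_AbsRing C_NormedModule
    (hyp2F1_term (RtoC 1) (RtoC (1 + d)) (RtoC (2 + a)) t)
  /\
  exists S : C,
    (* the series over n >= 1, indexed by k = n - 1 *)
    @is_series C_AbsRing C_NormedModule
      (fun k : nat =>
         let n := (k + 1)%nat in
         ((t * Cpower (1 - t) (RtoC c)) ^ n
          * (Cpochhammer (RtoC (1 - d + a * (c + 1) + INR n * c)) (n - 1)
             / RtoC (INR (fact (n - 1)) * (INR n + a))))%C) S
    /\
    (t / RtoC (1 + a)
     * hyp2F1 (RtoC 1) (RtoC (1 + d)) (RtoC (2 + a)) t)%C
    = (Cpower (1 - t) (RtoC (a * (c + 1) - d)) * S)%C.
Proof.
  assert (Hx : 0 <= Cmod t < 1) by (split; [apply Cmod_ge_0|exact ht]).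
  set (e := row_exp a c d). set (b := row_coef a c d).
  set (e0 := shift_exp a c d).
  destruct (diagonal_rearrangement
    (fun n k => RtoC (b n) * t ^ n * (RtoC (binom_coef (e n) k) * t ^ k))%C
    (fun n => RtoC (b n) * t ^ n * Cpower (1 - t) (RtoC (e n)))%C
    (fun n => Rabs (b n) * Cmod t ^ n
       * Rpower (1 - Cmod t) (- (INR (n + 1) * (- c) + Rabs e0)))) as (l & Hrow & Hdiag).
  { intros n. apply (is_series_scal (K := C_AbsRing) (V := C_NormedModule)).
    now apply binomial_series. }
  { intros n m. set (s := INR (n + 1) * - c + Rabs e0).
    assert (Hs : 0 <= INR (n + 1) * - c)
      by (apply Rmult_le_pos; [apply pos_INR|lra]).
    pose proof (Rabs_pos e0) as He0.
    apply Rle_trans with (sum_n (fun k => Rabs (b n) * Cmod t ^ n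
        * (poch s k / INR (fact k) * Cmod t ^ k)) m).
    - rewrite !sum_n_Reals. apply sum_Rle. intros k _.
      rewrite !Cmod_mult, !Cmod_R, !Cmod_pow.
      apply Rmult_le_compat_l.
      { apply Rmult_le_pos; [apply Rabs_pos|apply pow_le; lra]. }
      apply Rmult_le_compat_r; [apply pow_le; lra|].
      apply binom_coef_abs_le. unfold e, row_exp, s.
      apply Rle_trans with (1 := Rabs_triang _ _). fold e0.
      rewrite <- (Rabs_Ropp (_ * c)), <- Ropp_mult_distr_r_reverse.
      rewrite (Rabs_pos_eq (_ * _)) by exact Hs. apply Rle_refl.
    - rewrite (sum_n_mult_l (K := R_Ring)). apply Rmult_le_compat_l.
      { apply Rmult_le_pos; [apply Rabs_pos|apply pow_le; lra]. }
      apply binomial_partial_sum_le; [unfold s; lra|exact Hx]. }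
  { apply ex_series_majorant; trivial. lra. }
  assert (Ha : RtoC (1 + a) <> RtoC 0) by (intros Z; apply RtoC_inj in Z; lra).
  assert (Hhyp : Cis_series (hyp2F1_term (RtoC 1) (RtoC (1 + d)) (RtoC (2 + a)) t)
                   (RtoC (1 + a) * l)%C).
  { apply (is_series_ext (K := C_AbsRing) (V := C_NormedModule))
      with (2 := is_series_scal (K := C_AbsRing) (V := C_NormedModule)
                   (RtoC (1 + a)) _ _ Hdiag).
    intros N. unfold b, e. rewrite row_diagonal_term by lra.
    rewrite RtoC_inv by lra.
    change (RtoC (1 + a) * (/ RtoC (1 + a)
      * hyp2F1_term (RtoC 1) (RtoC (1 + d)) (RtoC (2 + a)) t N)
      = hyp2F1_term (RtoC 1) (RtoC (1 + d)) (RtoC (2 + a)) t N)%C.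
    field. exact Ha. }
  split; [eexists; exact Hhyp|].
  (* Moves [(1 - t)^e0] from the rows to the front of the series. *)
  assert (Hinv : (Cpower (1 - t) (RtoC e0) * Cpower (1 - t) (RtoC (- e0)) = 1)%C).
  { rewrite <- Cpower_plus, Rplus_opp_r. apply Cpower_0. }
  exists (Cpower (1 - t) (RtoC (- e0)) * t * l)%C. split.
  - apply (is_series_ext (K := C_AbsRing) (V := C_NormedModule))
      with (2 := is_series_scal (K := C_AbsRing) (V := C_NormedModule)
                   (Cpower (1 - t) (RtoC (- e0)) * t)%C _ _ Hrow).
    intros k. cbv zeta. rewrite Nat.add_sub, Cpochhammer_RtoC.
    replace (1 - d + a * (c + 1) + INR (k + 1) * c) with (1 + e k)
      by (unfold e, row_exp, shift_exp; ring).
    rewrite <- RtoC_div.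
    2: { rewrite plus_INR. simpl (INR 1). pose proof (pos_INR k).
         pose proof (INR_fact_lt_0 k). nra. }
    change (poch (1 + e k) k / (INR (fact k) * (INR (k + 1) + a))) with (b k).
    rewrite Cpow_mult_l, <- Cpower_INR.
    unfold e at 1, row_exp. fold e0. rewrite Cpower_plus.
    replace (t ^ (k + 1))%C with (t * t ^ k)%C by (rewrite Nat.add_1_r; apply Cpow_S).
    set (P := Cpower (1 - t) (RtoC (INR (k + 1) * c))).
    transitivity ((Cpower (1 - t) (RtoC e0) * Cpower (1 - t) (RtoC (- e0)))
                  * (t * t ^ k * P * RtoC (b k)))%C.
    + change (Cpower (1 - t) (RtoC (- e0)) * t
        * (RtoC (b k) * t ^ k * (P * Cpower (1 - t) (RtoC e0)))
        = Cpower (1 - t) (RtoC e0) * Cpower (1 - t) (RtoC (- e0))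
          * (t * t ^ k * P * RtoC (b k)))%C. ring.
    + rewrite Hinv.
      match goal with |- ?u = ?v => change (@eq C u v) end. ring.
  - fold (shift_exp a c d). fold e0.
    unfold hyp2F1. rewrite (CSeries_unique _ _ Hhyp).
    transitivity ((Cpower (1 - t) (RtoC e0) * Cpower (1 - t) (RtoC (- e0))) * (t * l))%C.
    + rewrite Hinv. field. exact Ha.
    + ring.
Qed.
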